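(* Let $k\ge 2$ be an integer and let $c,\alpha>0$ be constants such that $\mathrm{ex}_{\mathrm{bip}}(n, \mathscr{C}_{2k-2}) \ge (1+o(1))\, c\left(\frac{n}{2}\right)^{\alpha}$ as $n\to\infty$. Then $$\mathrm{ex}^{\mathrm{lin}}_3(n, \mathscr{C}^{\mathrm{lin}}_{2k+1}) \ge (1+o(1))\, \frac{\alpha c}{4\alpha-2}\cdot\left(\frac{\alpha-1}{c(2\alpha-1)}\right)^{1-\frac{1}{\alpha}} n^{2-\frac{1}{\alpha}} = \Omega\!\left(n^{2-\frac{1}{\alpha}}\right).$$
   Context: For a family $\mathcal F$ of graphs, $\mathrm{ex}_{\mathrm{bip}}(n,\mathcal F)$ is the maximum number of edges in a bipartite (simple) graph on $n$ vertices containing no member of $\mathcal F$ as a subgraph. $\mathscr{C}_{2k-2}$ denotes the family of cycles $C_l$ with $l$ even and $2\le l\le 2k-2$; for simple graphs the ''cycle'' $C_2$ imposes no restriction, so a graph is $\mathscr{C}_{2k-2}$-free iff it has no cycle of length at most $2k-2$ of even length. A $3$-uniform hypergraph has all hyperedges of size $3$; it is linear if any two distinct hyperedges share at most one vertex. A linear cycle $C^{\mathrm{lin}}_l$ of length $l\ge 3$ is an alternating sequence $v_1,h_1,v_2,h_2,\dots,v_l,h_l$ of distinct vertices and distinct hyperedges with $h_i\cap h_{i+1}=\{v_{i+1}\}$ for $1\le i\le l-1$, $h_1\cap h_l=\{v_1\}$, and $h_i\cap h_j=\emptyset$ whenever $1<|j-i|<l-1$. $\mathscr{C}^{\mathrm{lin}}_{2k+1}$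 denotes the family $\{C^{\mathrm{lin}}_3, C^{\mathrm{lin}}_5,\dots,C^{\mathrm{lin}}_{2k+1}\}$ of linear cycles of odd length between $3$ and $2k+1$. $\mathrm{ex}^{\mathrm{lin}}_3(n,\mathcal F)$ is the maximum number of hyperedges in a $3$-uniform linear hypergraph on $n$ vertices containing no member of $\mathcal F$ as a subhypergraph. *)

(* Defs.v *)
From mathcomp Require Import all_boot all_order all_algebra.
From mathcomp Require Import all_classical all_reals all_analysis.

Set Implicit Arguments.
Unset Strict Implicit.
Unset Printing Implicit Defensive.

Import Order.TTheory GRing.Theory Num.Theory.
Import numFieldNormedType.Exports.

Local Open Scope classical_set_scope.

(* A hypergraph on the vertex set V is given by its set of hyperedges;
   2-uniform hypergraphs are the simple graphs on V. *)

Definition uniform (V : finType) (r : nat) (E : {set {set V}}) : Prop :=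
  forall e, e \in E -> #|e| = r.

Definition bipartite (V : finType) (E : {set {set V}}) : Prop :=
  exists A : {set V}, forall e, e \in E -> #|e :&: A| = 1%N /\ #|e :\: A| = 1%N.

Definition linear_hypergraph (V : finType) (E : {set {set V}}) : Prop :=
  forall e f, e \in E -> f \in E -> e != f -> (#|e :&: f| <= 1)%N.

(* Vertices and edges of cycles are indexed cyclically by 'I_l, with ordS the
   cyclic successor.  As the edges are required to be distinct, no simple graph
   contains a cycle of length 2. *)

Definition has_cycle (V : finType) (E : {set {set V}}) (l : nat) : Prop :=
  exists (v : 'I_l -> V) (e : 'I_l -> {set V}),
    [/\ injective v, injective e, forall i, e i \in E
      & forall i, e i = [set v i; v (ordS i)]%SET].

(* Subtraction on nat being truncated, 1 < j - i < l - 1 only constrains pairs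
   i < j, which is enough because disjointness is symmetric. *)

Definition has_linear_cycle (V : finType) (E : {set {set V}}) (l : nat) : Prop :=
  exists (v : 'I_l -> V) (h : 'I_l -> {set V}),
    [/\ injective v, injective h, forall i, h i \in E,
        forall i, h i :&: h (ordS i) = [set v (ordS i)]%SET
      & forall i j : 'I_l, (1 < j - i < l.-1)%N -> h i :&: h j = finset.set0].

(* A family of (linear) cycles is represented by its set of lengths. *)

Definition even_lengths (m : nat) : set nat :=
  [set l | ~~ odd l /\ (2 <= l <= m)%N].

Definition odd_lengths (m : nat) : set nat :=
  [set l | odd l /\ (3 <= l <= m)%N].

Definition ex_bip (n : nat) (L : set nat) : nat :=
  \max_(E : {set {set 'I_n}} |
      `[< [/\ uniform 2 E, bipartite E
            & forall l, L l -> ~ has_cycle E l] >]) #|E|.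

Definition ex_lin3 (n : nat) (L : set nat) : nat :=
  \max_(E : {set {set 'I_n}} |
      `[< [/\ uniform 3 E, linear_hypergraph E
            & forall l, L l -> ~ has_linear_cycle E l] >]) #|E|.

Local Open Scope ring_scope.

(* f n >= (1 + o(1)) g n as n tends to infinity *)
Definition asymp_ge (R : realType) (f g : nat -> R) : Prop :=
  exists2 e : nat -> R, e @ \oo --> (0 : R)
    & \forall n \near \oo, (1 + e n) * g n <= f n.

(* Main.v *)
(* Let G be a bipartite graph with z vertices, m edges and no even cycle of length
   at most 2k - 2. Replace every vertex a by q copies a_i, add a new vertex v_e for
   every edge e, and take the mq triples {a_i, b_i, v_e} with e = ab. A linear cycle
   of odd length l <= 2k + 1 in this system projects to a closed walk in G. By
   parity the walk crosses some edge e "through v_e", and by linearity it uses e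
   nowhere else; since the index i changes only at the vertices v_e, it visits at
   least two of them, so that at most l - 2 of its steps are moves. Removing
   e leaves a walk that closes e up to a cycle of G, even and of length <= 2k - 2.
   Hence ex_lin3(n) >= m (n - m - z) / z, and one optimizes z ~ 2 (lambda n)^(1/alpha)
   and m ~ c lambda n: the best lambda is (alpha - 1) / (c (2 alpha - 1)) for
   alpha > 1, lambda -> 0 for alpha = 1. For alpha < 1 the exponent 2 - 1/alpha is
   below 1 and a linear lower bound suffices, whatever the junk values of the
   prefactor (division by 0, power of a negative number). *)

Require Import Defs.
From mathcomp Require Import all_boot all_order all_algebra.
From mathcomp Require Import all_classical all_reals all_analysis.
From mathcomp Require Import zify ring lra.

Set Implicit Arguments.
Unset Strict Implicit.
Unset Printing Implicit Defensive.

Import Order.TTheory GRing.Theory Num.Theory.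
Import numFieldNormedType.Exports.

Local Open Scope classical_set_scope.

(** * Edges, bipartitions, walks and cycles in graphs *)

Lemma uniform2_eq_set2 (T : finType) (E : {set {set T}}) (e : {set T}) (x y : T) :
  uniform 2 E -> e \in E -> x \in e -> y \in e -> x != y -> e = [set x; y]%SET.
Proof.
move=> uE eE xe ye xy; apply/esym/eqP; rewrite eqEcard uE // cards2 xy leqnn andbT.
by apply/fintype.subsetP => w; rewrite !inE => /orP[]/eqP->.
Qed.

Lemma bipartition_edge (T : finType) (A e : {set T}) (x y : T) :
  #|e :&: A| = 1%N -> #|e :\: A| = 1%N -> x \in e -> y \in e -> x != y ->
  (y \in A) = ~~ (x \in A).
Proof.
move=> /eqP/cards1P[a ea] /eqP/cards1P[b eb] xe ye; apply: contraNeq => yA.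
have same C c : (e :&: C)%SET = [set c]%SET -> x \in C -> y \in C -> x == y.
  move=> eC xC yC.
  have : x \in (e :&: C)%SET by rewrite inE xe.
  have : y \in (e :&: C)%SET by rewrite inE ye.
  by rewrite eC !inE => /eqP-> /eqP->.
move: yA; have [xA|xA] := boolP (x \in A) => yA.
  by apply: same ea _ _ => //; case: (y \in A) yA.
rewrite finset.setDE in eb.
by apply: same eb _ _ => //; rewrite inE //; case: (y \in A) yA.
Qed.

(** Dropping the steps at which [p] stands still turns a lazy walk into a genuine path, no longer
    than the time elapsed. *)
Lemma lazy_walk_path (T : finType) (r : rel T) (p : nat -> T) (a b : nat) :
  (a <= b)%N ->
  (forall j, (a <= j < b)%N -> p j = p j.+1 \/ r (p j) (p j.+1)) ->
  exists s, [/\ path r (p a) s, last (p a) s = p b & (size s <= b - a)%N].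
Proof.
elim: b => [|b IHb] ab step.
  by exists [::]; split=> //=; congr p; lia.
have [ab'|ab'] := leqP a b; last first.
  by exists [::]; split=> //=; congr p; lia.
have [|s [s1 s2 s3]] := IHb ab'; first by move=> j jab; apply: step; lia.
have [e|e] := step b ltac:(lia).
  by exists s; split=> //; [rewrite s2 | lia].
exists (rcons s (p b.+1)); split.
- by rewrite rcons_path s1 s2.
- by rewrite last_rcons.
- by rewrite size_rcons; lia.
Qed.

Lemma path_bipartite (T : finType) (r : rel T) (A : {set T}) (x : T) (s : seq T) :
  (forall x y, r x y -> (y \in A) = ~~ (x \in A)) ->
  path r x s -> (last x s \in A) = (x \in A) (+) odd (size s).
Proof.
move=> rA; elim: s x => [|y s IHs] x /=; first by rewrite addbF.
by case/andP=> /rA xy /IHs ->; rewrite xy addNb addbN.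
Qed.

Lemma set2_eqP (T : finType) (x y z t : T) :
  [set x; y]%SET = [set z; t]%SET -> (x = z /\ y = t) \/ (x = t /\ y = z).
Proof.
move=> exy.
have := set21 x y; have := set22 x y; rewrite exy !inE.
have := set21 z t; have := set22 z t; rewrite -exy !inE.
do 4!case/orP=> /eqP ?; subst; tauto.
Qed.

Lemma path_has_cycle (T : finType) (E : {set {set T}}) (x y : T) (s : seq T) :
  path (fun u w => [set u; w]%SET \in E) x s -> uniq (x :: s) -> last x s = y ->
  [set y; x]%SET \in E -> (1 < size s)%N -> has_cycle E (size s).+1.
Proof.
move=> xs us lxs yxE s1.
pose v (i : 'I_(size s).+1) := nth x (x :: s) i.
have vinj : injective v.
  by move=> i j /eqP; rewrite /v nth_uniq //= ?ltn_ord // => /eqP/val_inj.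
exists v, (fun i => [set v i; v (ordS i)]%SET); split=> //.
(* Equal edges with swapped ends would make [i] and [j] successors of each other, impossible since
   the length is at least 3. *)
- move=> i j /set2_eqP[[/vinj//]|[/vinj ij /vinj ji]].
  have /(congr1 val) /= ij' := ij; have /(congr1 val) /= ji' := ji.
  move: (ltn_ord i) (ltn_ord j) => ilt jlt.
  have modS a : (a < (size s).+1)%N ->
      a.+1 %% (size s).+1 = if a == size s then 0%N else a.+1.
    move=> alt; case: eqP => [->|na]; first by rewrite modnn.
    by rewrite modn_small //; lia.
  move: ij' ji'; rewrite !modS //.
  by case: eqP; case: eqP; lia.
- move=> i; rewrite /v /=.
  have [ilt|ige] := ltnP i (size s).
    rewrite modn_small ?ltnS //.
    have /(pathP x) := xs; exact.
  have -> : nat_of_ord i = size s by have := ltn_ord i; lia.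
  by rewrite modnn /= -(last_nth x x s) lxs.
Qed.

(** * The triple system of a graph: size, uniformity, linearity *)

Section Construction.
Variables (T I : finType) (E : {set {set T}}).

Local Notation edge := {e : {set T} | e \in E}.

(* The hyperedge {a_i, b_i, v_e} for the edge e = {a, b} of G and the index i. *)
Definition triple (p : edge * I) : {set T * I + edge} :=
  [set w | match w with
           | inl xi => (xi.1 \in val p.1) && (xi.2 == p.2)
           | inr e => e == p.1
           end]%SET.

Definition triple_system : {set {set T * I + edge}} := [set triple p | p : edge * I]%SET.

Lemma inl_triple x i p : (inl (x, i) \in triple p) = (x \in val p.1) && (i == p.2).
Proof. by rewrite inE. Qed.

Lemma inr_triple e p : (inr e \in triple p) = (e == p.1).
Proof. by rewrite inE. Qed.

Lemma card_triple_vertices : #|{: T * I + edge}| = (#|T| * #|I| + #|E|)%N.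
Proof. by rewrite card_sum card_prod card_sig. Qed.

Hypothesis uE : uniform 2 E.

Lemma edge_ends (e : edge) :
  exists x y, [/\ x != y, x \in val e, y \in val e & val e = [set x; y]%SET].
Proof.
have /eqP/cards2P[x [y [xy e_xy]]] := uE (valP e).
by exists x, y; split; rewrite // e_xy !inE eqxx ?orbT.
Qed.

Lemma triple_inj : injective triple.
Proof.
move=> [e i] [f j] ef.
have /esym := inr_triple e (e, i); rewrite eqxx ef inr_triple => /esym/eqP /= ?; subst f.
have [x [_ [_ xe _ _]]] := edge_ends e.
have := inl_triple x i (e, i); rewrite ef inl_triple /= xe eqxx /= => /eqP->.
by [].
Qed.

Lemma card_triple_system : #|triple_system| = (#|E| * #|I|)%N.
Proof. by rewrite card_imset; [rewrite card_prod card_sig | exact: triple_inj]. Qed.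

Lemma triple_system_uniform : uniform 3 triple_system.
Proof.
move=> _ /imsetP[[e i] _ ->]; have [x [y [xy xe ye exy]]] := edge_ends e.
have -> : triple (e, i) = [set inr e; inl (x, i); inl (y, i)]%SET.
  apply/setP => -[[u j]|f]; rewrite !inE /=.
    by rewrite exy !inE !(inj_eq inl_inj) !xpair_eqE -andb_orl.
  by rewrite (inj_eq inr_inj) !orbF.
by rewrite -finset.setUA cardsU1 cards2 !inE (inj_eq inl_inj) xpair_eqE (negbTE xy).
Qed.

(** Two common copies of vertices force the same index and the same two ends, hence the same edge; a
    common apex v_e and a common copy also force the same edge and index. *)
Lemma triple_system_linear : linear_hypergraph triple_system.
Proof.
move=> _ _ /imsetP[[e i] _ ->] /imsetP[[f j] _ ->] ef.
apply/card_le1_eqP => -[[x a]|g] [[y b]|g']; rewrite !inE /=.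
- case/andP=> /andP[xe /eqP ai] /andP[xf /eqP aj].
  case/andP=> /andP[ye /eqP bi] /andP[yf /eqP bj]; subst.
  have [->//|xy] := eqVneq x y.
  case/negP: ef; apply/eqP; congr (triple (_, _)).
  by apply: val_inj; rewrite (uniform2_eq_set2 uE (valP e) xe ye xy);
    exact/esym/(uniform2_eq_set2 uE (valP f) xf yf xy).
- case/andP=> /andP[xe /eqP ai] /andP[xf /eqP aj] /andP[/eqP -> /eqP eef].
  by move: ef; rewrite -ai -aj /= eef eqxx.
- case/andP=> /eqP -> /eqP eef /andP[/andP[xe /eqP ai] /andP[xf /eqP aj]].
  by move: ef; rewrite -ai -aj /= eef eqxx.
- by case/andP=> /eqP -> _ /andP[/eqP -> _].
Qed.

(** * Linear cycles unrolled to periodic walks *)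

Section CyclicWalk.
Variables (l : nat) (v : nat -> T * I + edge) (p : nat -> edge * I).

(** Times range over nat with period [l], so that the origin can be moved freely. [walk_inr] keeps
    what is needed of linearity: an apex v_e met at time i lies only in the triples i - 1 and i
    (modulo l), so e is absent from the triples i + 1 to i + l - 2. *)
Record cyclic_walk : Prop := CyclicWalk {
  walk_mem : forall j, v j \in triple (p j);
  walk_memS : forall j, v j.+1 \in triple (p j);
  walk_vertexS : forall j, v j != v j.+1;
  walk_tripleS : forall j, p j != p j.+1;
  walk_inr : forall (e : edge) i j, v i = inr e -> (i < j < i + l.-1)%N -> (p j).1 != e;
  walk_vertex_period : forall j, v (j + l) = v j;
  walk_triple_period : forall j, p (j + l) = p j }.
End CyclicWalk.

Lemma cyclic_walk_shift l v p d : cyclic_walk l v p ->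
  cyclic_walk l (fun j => v (j + d)%N) (fun j => p (j + d)%N).
Proof.
case=> h1 h2 h3 h4 h5 h6 h7; split=> [j|j|j|j|e i j vi ij|j|j]; rewrite ?addSn //.
- by apply: h5 vi _; lia.
- by rewrite addnAC.
- by rewrite addnAC.
Qed.

Lemma linear_cycle_walk l : (2 < l)%N -> has_linear_cycle triple_system l ->
  exists v p, cyclic_walk l v p.
Proof.
move=> l2 [v [h [vinj hinj hE hS hD]]].
have l0 : (0 < l)%N by lia.
have hP i : exists p, h i = triple p by have /imsetP[p _ ->] := hE i; exists p.
have [p hp] := choice hP.
pose o j : 'I_l := Ordinal (ltn_pmod j l0).
have oS j : o j.+1 = ordS (o j).
  by apply: val_inj; rewrite /= -[in RHS]addn1 modnDml addn1.
have hSE w j : (w \in h (o j)) && (w \in h (o j.+1)) = (w == v (o j.+1)).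
  by rewrite -finset.in_setI oS hS inE.
have oj j : o (j + l) = o j by apply: val_inj; rewrite /= modnDr.
have oneq i j : (i < j < i + l)%N -> o i != o j.
  move=> ij; apply/eqP => /(congr1 val) /= /eqP.
  have -> : j = (i + (j - i))%N by lia.
  by rewrite -[in X in X == _](addn0 i) eqn_modDl mod0n modn_small; lia.
have memS j : v (o j.+1) \in h (o j) by have := hSE (v (o j.+1)) j; rewrite eqxx => /andP[].
(* The predecessor of j is taken as j + l - 1, which is also correct at j = 0. *)
have mem j : v (o j) \in h (o j).
  have := hSE (v (o j)) (j + l.-1)%N.
  rewrite (_ : (j + l.-1).+1 = (j + l)%N) ?oj ?eqxx; last lia.
  by case/andP.
exists (v \o o), (p \o o); split=> /= [j|j|j|j|e i j vi ij|j|j]; rewrite -?hp ?oj //.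
- by rewrite (inj_eq vinj) oneq //; lia.
- apply/negP => /eqP pj; have : o j != o j.+1 by apply: oneq; lia.
  by rewrite -(inj_eq hinj) !hp pj eqxx.
- apply/negP => /eqP pj.
  have ei : inr e \in h (o i) by rewrite -vi.
  have ej : inr e \in h (o j) by rewrite hp inr_triple pj.
  (* An apex common to consecutive hyperedges i and i + 1 would be the vertex i + 1 of the cycle,
     but it is the vertex i. *)
  have [jS|jS] := eqVneq j i.+1.
    subst j; have := hSE (inr e) i; rewrite ei ej -vi (inj_eq vinj) => /esym.
    by apply/negP; apply: oneq; lia.
  have eij : inr e \in h (o i) :&: h (o j) by rewrite inE ei.
  (* After reduction modulo l the two residues may come in either order, whereas [hD] only speaks of
     increasing pairs. *)
  have : (1 < o j - o i < l.-1)%N || (1 < o i - o j < l.-1)%N.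
    have [d jd] : exists d, j = (i + d)%N by exists (j - i)%N; lia.
    rewrite /= jd -modnDml; move: (i %% l)%N (ltn_pmod i l0) => a al.
    have [adl|adl] := ltnP (a + d) l; first by rewrite modn_small //; lia.
    have -> : (a + d)%N = ((a + d - l) + l)%N by lia.
    rewrite modnDr modn_small; lia.
  by case/orP=> /hD; [|rewrite finset.setIC]; move=> D; move: eij; rewrite D inE.
Qed.

(** * Projection of the walk to the graph, and extraction of a short even cycle *)

Variable A : {set T}.
Hypothesis bE : forall e, e \in E -> #|e :&: A| = 1%N /\ #|e :\: A| = 1%N.

Section Walk.
Variables (l : nat) (v : nat -> T * I + edge) (p : nat -> edge * I).
Hypothesis W : cyclic_walk l v p.

Lemma walk_inl j x i : v j = inl (x, i) -> x \in val (p j).1 /\ i = (p j).2.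
Proof. by move=> vj; have := walk_mem W j; rewrite vj inl_triple => /andP[-> /eqP]. Qed.

Lemma walk_inlS j x i : v j.+1 = inl (x, i) -> x \in val (p j).1 /\ i = (p j).2.
Proof. by move=> vj; have := walk_memS W j; rewrite vj inl_triple => /andP[-> /eqP]. Qed.

Lemma walk_inrE j e : v j = inr e -> e = (p j).1.
Proof. by move=> vj; have := walk_mem W j; rewrite vj inr_triple => /eqP. Qed.

Lemma walk_inrES j e : v j.+1 = inr e -> e = (p j).1.
Proof. by move=> vj; have := walk_memS W j; rewrite vj inr_triple => /eqP. Qed.

Lemma walk_inr_inl j e : v j = inr e -> exists x, v j.+1 = inl (x, (p j).2).
Proof.
move=> vj; case vS : (v j.+1) => [[x i]|f].
  by exists x; have [_ ->] := walk_inlS vS.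
by have := walk_vertexS W j; rewrite vj vS (walk_inrE vj) (walk_inrES vS) eqxx.
Qed.

(* The projection to G of the closed walk; at v_e it is already at its next
   position. *)
Definition position (x0 : T) j :=
  match v j, v j.+1 with
  | inl xi, _ => xi.1
  | inr _, inl xi => xi.1
  | _, _ => x0
  end.

(** The delicate case is the arrival at an apex v_e: the position there is read off at time j + 2,
    from a triple which contains v_e and therefore has the same edge e. *)
Lemma position_step x0 j :
  position x0 j = position x0 j.+1 \/
  position x0 j \in val (p j).1 /\ position x0 j.+1 \in val (p j).1.
Proof.
rewrite /position; case vj : (v j) => [[x i]|e].
  have [xp _] := walk_inl vj; case vS : (v j.+1) => [[y i']|f].
    by right; have [yp _] := walk_inlS vS.
  have [y vSS] := walk_inr_inl vS; rewrite vSS; right; split=> //=.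
  have [+ _] := walk_inlS vSS.
  by rewrite -(walk_inrE vS) (walk_inrES vS).
by have [y ->] := walk_inr_inl vj; left.
Qed.

Lemma position_stay x0 j e : v j = inr e -> position x0 j = position x0 j.+1.
Proof. by move=> vj; have [y vS] := walk_inr_inl vj; rewrite /position vj vS. Qed.

Lemma position_period x0 j : position x0 (j + l) = position x0 j.
Proof. by rewrite /position -addSn !(walk_vertex_period W). Qed.

Definition is_apex j := if v j is inr _ then true else false.

Lemma position_move x0 j : ~~ is_apex j -> ~~ is_apex j.+1 ->
  position x0 j != position x0 j.+1.
Proof.
rewrite /is_apex /position; case vj : (v j) => [[x i]|//] _.
case vS : (v j.+1) => [[y i']|//] _.
have := walk_vertexS W j; rewrite vj vS /=.
have [_ ->] := walk_inl vj; have [_ ->] := walk_inlS vS.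
by apply: contra => /eqP->.
Qed.

(* If no v_e were crossed from one end of e to the other, then the side of the
   position would change exactly at the steps not touching any v_e, whose number
   has the parity of l. *)
Lemma odd_walk_crossing x0 : odd l ->
  exists j, is_apex j.+1 && (position x0 j != position x0 j.+1).
Proof.
move=> lodd; apply: contrapT => /forallNP no.
(* Without a crossing, each step changes exactly one of the side of the position and [is_apex], so
   this sum is constant; at j = l periodicity and the oddness of l contradict it. *)
have inv j : (position x0 j \in A) (+) is_apex j (+) odd j =
             (position x0 0 \in A) (+) is_apex 0.
  elim: j => [|j <-]; first by rewrite addbF.
  rewrite /= addbN -addNb -addNb; congr (_ (+) _).
  have := no j; case vS : (is_apex j.+1) => /=.
    move/negP; rewrite negbK => /eqP <-.
    case vj : (is_apex j) => //=.
      move: vj vS; rewrite /is_apex; case vj : (v j) => [//|e] _.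
      by have [y ->] := walk_inr_inl vj.
    by rewrite addbT negbK addbF.
  move=> _; rewrite addbF; case vj : (is_apex j) => /=.
    move: vj; rewrite /is_apex; case vj : (v j) => [//|e] _.
    by rewrite (position_stay _ vj) addbT.
  have ne : position x0 j != position x0 j.+1.
    by apply: position_move; rewrite ?vj ?vS.
  rewrite addbF; have [e|[xp yp]] := position_step x0 j; first by rewrite e eqxx in ne.
  have [b1 b2] := bE (valP (p j).1).
  by rewrite (bipartition_edge b1 b2 xp yp ne) negbK.
have := inv l; rewrite lodd -[in position x0 l](add0n l) position_period.
rewrite /is_apex -[in v l](add0n l) (walk_vertex_period W).
by case: (_ \in A); case: (v 0%N).
Qed.

End Walk.

(** With the crossing of e shifted to time 0, the walk from time 2 to time l joins the two ends of e
    inside G - e. A second apex makes it stand still once, leaving at most l - 3 moves; closing up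
    by e gives length at most l - 2. *)
Lemma odd_walk_has_cycle l v p : cyclic_walk l v p -> odd l -> (2 < l)%N ->
  exists n, [/\ ~~ odd n, (1 < n <= l.-2)%N & has_cycle E n].
Proof.
move=> W0 lodd l2.
have [x0 _] : exists x0 : T, True.
  by have [x [_ _]] := edge_ends (p 0%N).1; exists x.
have [d] := odd_walk_crossing W0 x0 lodd.
have := cyclic_walk_shift d W0.
set v1 := fun j => v (j + d)%N; set p1 := fun j => p (j + d)%N => W.
have -> : is_apex v d.+1 = is_apex v1 1 by rewrite /is_apex /v1 add1n.
have -> : position v x0 d = position v1 x0 0 by rewrite /position /v1 add0n add1n.
have -> : position v x0 d.+1 = position v1 x0 1 by rewrite /position /v1 add1n.
move: v1 p1 W => {W0 v p d} v p W.
rewrite /is_apex; case/andP; case v1 : (v 1%N) => [//|e] _ ne.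
have ep1 := walk_inrE W v1; have ep0 := walk_inrES W v1.
have [same|[xe ye]] := position_step W x0 0; first by rewrite same eqxx in ne.
pose r x y := [set x; y]%SET \in (E :\ val e)%SET.
have step j : (2 <= j < l)%N ->
    position v x0 j = position v x0 j.+1 \/ r (position v x0 j) (position v x0 j.+1).
  move=> jl; have [|[xp yp]] := position_step W x0 j; first by left.
  have [|xy] := eqVneq (position v x0 j) (position v x0 j.+1); first by left.
  right; rewrite /r -(uniform2_eq_set2 uE (valP (p j).1) xp yp xy) in_setD1 (valP (p j).1) andbT.
  by rewrite (inj_eq val_inj); apply: (walk_inr W v1); lia.
(* The index changes across the first v_e, so it must change back at another one. *)
have [j [jl vj]] : exists j, (2 <= j < l)%N /\ is_apex v j.
  apply: contrapT => /forallNP no.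
  have ixS j : (0 < j < l)%N -> (p j.+1).2 = (p 1%N).2.
    elim: j => // j IHj jl.
    have vS : ~~ is_apex v j.+2.
      apply/negP => vS; have [jl'|jl'] := ltnP j.+2 l.
        by apply: (no j.+2); split=> //; lia.
      (* At time l the vertex is that of time 0, which is no apex because an apex is never followed
         by an apex. *)
      have jE : j.+2 = l by lia.
      move: vS; rewrite /is_apex jE -(add0n l) (walk_vertex_period W).
      case v0 : (v 0%N) => [//|f] _; have [y] := walk_inr_inl W v0.
      by rewrite v1.
    have -> : (p j.+2).2 = (p j.+1).2.
      move: vS; rewrite /is_apex; case vS : (v j.+2) => [[x i]|//] _.
      by have [_ <-] := walk_inl W vS; have [_ <-] := walk_inlS W vS.
    by case: j IHj jl {vS} => // j IHj jl; apply: IHj; lia.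
  (* By periodicity the triples 0 and 1 get the same index; both have the edge e, so they would
     coincide. *)
  have := ixS l.-1 ltac:(lia); rewrite prednK; last lia.
  rewrite -(add0n l) (walk_triple_period W) => ix.
  have := walk_tripleS W 0.
  by rewrite (surjective_pairing (p 0%N)) (surjective_pairing (p 1%N)) ix -ep0 -ep1 eqxx.
have stay : position v x0 j = position v x0 j.+1.
  by move: vj; rewrite /is_apex; case vj : (v j) => [//|f] _; exact: (position_stay W x0 vj).
have [s1 [s1p s1l s1s]] := @lazy_walk_path T r (position v x0) 2 j ltac:(lia)
  (fun i Hi => step i ltac:(lia)).
have [s2 [s2p s2l s2s]] := @lazy_walk_path T r (position v x0) j.+1 l ltac:(lia)
  (fun i Hi => step i ltac:(lia)).
have e_xy : val e = [set position v x0 0; position v x0 1]%SET.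
  by rewrite ep0; exact: uniform2_eq_set2 uE (valP (p 0%N).1) xe ye ne.
have pos12 := position_stay W x0 v1.
have sp : path r (position v x0 1) (s1 ++ s2).
  by rewrite pos12 cat_path s1p s1l stay.
have sl : last (position v x0 1) (s1 ++ s2) = position v x0 0.
  by rewrite pos12 last_cat s1l stay s2l -(position_period W x0 0) add0n.
have ss : (size (s1 ++ s2) <= l.-2.-1)%N by rewrite size_cat; lia.
move: sl; case/shortenP: sp => s sp su sub sl.
have {}ss : (size s <= l.-2.-1)%N.
  by apply: leq_trans ss; apply: uniq_leq_size; [case/andP: su|].
have rA x y : r x y -> (y \in A) = ~~ (x \in A).
  rewrite /r in_setD1 => /andP[_ xyE]; have [b1 b2] := bE xyE.
  apply: (bipartition_edge b1 b2); rewrite ?set21 ?set22 //.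
  by apply/negP => /eqP xy; have := uE xyE; rewrite xy finset.setUid cards1.
(* The ends of e lie on opposite sides of the bipartition; length 1 is then excluded because e
   itself was removed. *)
have sodd : odd (size s).
  have := path_bipartite rA sp; rewrite sl.
  have [b1 b2] := bE (valP (p 0%N).1).
  rewrite (bipartition_edge b1 b2 xe ye ne).
  by case: (_ \in A); case: odd.
have s1' : (1 < size s)%N.
  case: s sl sp sodd {su sub ss} => [|y [|? ?]] //= -> /andP[+ _] _.
  by rewrite /r finset.setUC -e_xy setD11.
exists (size s).+1; split; [by rewrite /= sodd | lia|].
apply: (path_has_cycle _ su sl) => //.
- by apply: sub_path sp => x y; rewrite /r in_setD1 => /andP[].
- by rewrite -e_xy (valP e).
Qed.

End Construction.

(** The cycle obtained has length at most l - 2 <= 2k - 1, and being even at most 2k - 2. *)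
Lemma triple_system_no_odd_cycle (T I : finType) (E : {set {set T}}) (k l : nat) :
  uniform 2 E -> bipartite E ->
  (forall n, even_lengths (2 * k - 2) n -> ~ has_cycle E n) ->
  odd_lengths (2 * k + 1) l -> ~ has_linear_cycle (triple_system I E) l.
Proof.
move=> uE [A bE] noE [lodd /andP[l3 lk]] Hl.
have [v [p W]] := linear_cycle_walk l3 Hl.
have [n [neven n2 En]] := odd_walk_has_cycle uE bE W lodd l3.
by apply: noE En; split=> //; lia.
Qed.

(** * Relabelling of vertices and the inequality between the extremal numbers *)

Section Embedding.
Variables (V W : finType) (f : V -> W).
Hypothesis f_inj : injective f.
Variable E : {set {set V}}.

Let fE : {set {set W}} := [set f @: (e : {set V}) | e in E]%SET.

Lemma uniform_imset r : uniform r E -> uniform r fE.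
Proof. by move=> uE _ /imsetP[e eE ->]; rewrite card_imset ?uE. Qed.

Lemma linear_hypergraph_imset : linear_hypergraph E -> linear_hypergraph fE.
Proof.
move=> lE _ _ /imsetP[e eE ->] /imsetP[e' e'E ->] ee'.
rewrite -imsetI; last by move=> x y _ _; exact: f_inj.
by rewrite card_imset // lE //; apply: contra ee' => /eqP->.
Qed.

Lemma has_linear_cycle_imset l : (0 < l)%N -> has_linear_cycle fE l -> has_linear_cycle E l.
Proof.
move=> l0 [v [h [vinj hinj hE hS hD]]].
have preK (e : {set V}) : (f @^-1: (f @: e))%SET = e.
  by apply/setP => x; rewrite inE mem_imset.
have hpre i : f @^-1: h i \in E /\ h i = (f @: (f @^-1: h i))%SET.
  by have /imsetP[e eE ->] := hE i; rewrite preK.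
(* Each cycle vertex lies in a hyperedge of the image, hence in the range of [f]. *)
have vpre i : exists x, v i = f x.
  have [j ->] : exists j, i = ordS j by exists (ord_pred i); rewrite ord_predK.
  have : v (ordS j) \in h j by have := set11 (v (ordS j)); rewrite -hS inE => /andP[].
  by have [_ ->] := hpre j; case/imsetP => x _ ->; exists x.
have [u vu] := choice vpre.
exists u, (fun i => f @^-1: h i)%SET; split.
- by move=> i j uij; apply: vinj; rewrite !vu uij.
- by move=> i j hij; apply: hinj; rewrite (hpre i).2 (hpre j).2 hij.
- by move=> i; have [] := hpre i.
- move=> i; rewrite -preimsetI hS; apply/setP => x.
  by rewrite !inE vu (inj_eq f_inj).
- by move=> i j ij; rewrite -preimsetI hD // preimset0.
Qed.
End Embedding.

Lemma ex_lin3_ge (V : finType) (n : nat) (L : set nat) (H : {set {set V}}) :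
  (#|V| <= n)%N -> (forall l, L l -> (0 < l)%N) ->
  uniform 3 H -> linear_hypergraph H -> (forall l, L l -> ~ has_linear_cycle H l) ->
  (#|H| <= ex_lin3 n L)%N.
Proof.
move=> Vn L0 uH lH noH.
pose f (x : V) : 'I_n := widen_ord Vn (enum_rank x).
have f_inj : injective f.
  by move=> x y /(congr1 val) /= /val_inj /enum_rank_inj.
rewrite -(card_imset _ (imset_inj f_inj)) /ex_lin3.
apply: (leq_bigmax_cond (F := fun E : {set {set 'I_n}} => #|E|)); apply/asboolP; split.
- exact: uniform_imset.
- exact: linear_hypergraph_imset.
- by move=> l Ll /(has_linear_cycle_imset f_inj (L0 _ Ll)); exact: noH.
Qed.

(** Deleting edges preserves all conditions, so every positive edge number up to the maximum is
    attained; this leaves m free for the optimization. *)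
Lemma ex_bip_witness (n m : nat) (L : set nat) : (0 < m <= ex_bip n L)%N ->
  exists E : {set {set 'I_n}}, [/\ uniform 2 E, bipartite E,
    forall l, L l -> ~ has_cycle E l & #|E| = m].
Proof.
case/andP=> m0 mex; suff [E [uE [A bE] noE mE]] : exists E : {set {set 'I_n}},
    [/\ uniform 2 E, bipartite E, forall l, L l -> ~ has_cycle E l & (m <= #|E|)%N].
  pose F : {set {set 'I_n}} := [set e in take m (enum E)]%SET.
  have FE e : e \in F -> e \in E by rewrite inE => /mem_take; rewrite mem_enum.
  exists F; split.
  - by move=> e /FE /uE.
  - by exists A => e /FE; exact: bE.
  - move=> l Ll [v [h [vinj hinj hF hv]]]; apply: (noE l Ll); exists v, h; split=> //.
    by move=> i; apply: FE.
  - rewrite cardsE; have /card_uniqP -> : uniq (take m (enum E)) by rewrite take_uniq ?enum_uniq.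
    by rewrite size_takel // -cardE.
apply: contrapT => /forallNP no; move: mex; apply/negP; rewrite -ltnNge -(prednK m0) ltnS.
apply/bigmax_leqP => E /asboolP[uE bE noE].
rewrite -ltnS prednK // ltnNge; apply/negP => mE; by apply: (no E); split.
Qed.

(** With q = (n - m) / z copies of each vertex, rounded down, the triple system has qz + m <= n
    vertices and mq triples. *)
Lemma ex_lin3_ge_ex_bip (k n z m : nat) : (m <= n)%N -> (0 < z)%N ->
  (m <= ex_bip z (even_lengths (2 * k - 2)))%N ->
  (m * ((n - m) %/ z) <= ex_lin3 n (odd_lengths (2 * k + 1)))%N.
Proof.
move=> mn z0 mex; have [->//|m0] := posnP m.
have [E [uE bE noE mE]] := @ex_bip_witness z m (even_lengths (2 * k - 2)) ltac:(by rewrite m0).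
have := @card_triple_system _ 'I_((n - m) %/ z) E uE; rewrite card_ord mE => <-.
apply: ex_lin3_ge.
- by rewrite card_triple_vertices card_ord card_ord mE mulnC; have := leq_trunc_div (n - m) z; lia.
- by move=> l [_]; lia.
- exact: triple_system_uniform.
- exact: triple_system_linear.
- by move=> l; exact: triple_system_no_odd_cycle.
Qed.

Local Open Scope ring_scope.

(** * Asymptotic estimates with a factor rho < 1 in place of 1 + o(1) *)

Section Asymptotics.
Variable R : realType.
Implicit Types (f g : nat -> R) (c alpha lambda mu rho : R).

Lemma asymp_ge_near f g rho : asymp_ge f g -> (forall n, 0 <= g n) -> rho < 1 ->
  \forall n \near \oo, rho * g n <= f n.
Proof.
move=> [e e0 efg] g0 rho1; near=> n.
apply: (@le_trans _ _ ((1 + e n) * g n)); last by near: n.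
apply: ler_wpM2r => //; rewrite -lerBlDl.
have : `|0 - e n| < 1 - rho.
  by near: n; move/cvgr_dist_lt : e0; apply; rewrite subr_gt0.
by rewrite sub0r normrN ltr_norml => /andP[+ _]; lra.
Unshelve. all: by end_near. Qed.

Lemma near_asymp_ge f g : (forall n, 0 <= f n) -> (forall n, 0 <= g n) ->
  (forall rho, 0 < rho < 1 -> \forall n \near \oo, rho * g n <= f n) ->
  asymp_ge f g.
Proof.
move=> f0 g0 fg.
(* The error term is the relative deficit of [f] against [g], cut off at 0 where [f] exceeds [g]. *)
exists (fun n => if g n == 0 then 0 else Num.min 0 (f n / g n - 1)); last first.
  near=> n; have [->|gn] := eqVneq (g n) 0; first by rewrite mulr0.
  have gpos : 0 < g n by rewrite lt0r gn g0.
  rewrite -ler_pdivlMr // -lerBrDl.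
  by rewrite ge_min lexx orbT.
apply/cvgrPdist_le => eps eps0.
have bound n : (1 - eps) * g n <= f n ->
    `|0 - (if g n == 0 then 0 else Num.min 0 (f n / g n - 1))| <= eps.
  move=> gf; rewrite sub0r normrN.
  have [_|gn] := eqVneq (g n) 0; first by rewrite normr0 ltW.
  have gpos : 0 < g n by rewrite lt0r gn g0.
  rewrite ler_norml ge_min (ltW eps0) /= andbT le_min oppr_le0 (ltW eps0) /=.
  by rewrite -lerBlDr opprK ler_pdivlMr // addrC.
(* For eps >= 1 the factor 1 - eps is not positive, and nonnegativity of [f] suffices. *)
have [e1|e1] := leP 1 eps; near=> n; apply: bound.
  by apply: le_trans (f0 n); rewrite mulr_le0_ge0 // subr_le0.
by near: n; apply: fg; apply/andP; split; lra.
Unshelve. all: by end_near. Qed.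

Lemma near_powR_ge (C p lambda : R) : 0 < lambda -> 0 < p ->
  \forall n \near \oo, C <= (lambda * n%:R) `^ p.
Proof.
move=> l0 p0; near=> n.
apply: (le_trans (ler_norm C)).
have -> : `|C| = (`|C| `^ p^-1) `^ p by rewrite -powRrM mulVf ?gt_eqF // powRr1.
apply: ge0_ler_powR; [exact: ltW | by rewrite nnegrE powR_ge0 | |].
  by rewrite nnegrE mulr_ge0 // ltW.
by rewrite mulrC -ler_pdivrMr //; near: n; exact: nbhs_infty_ger.
Unshelve. all: by end_near. Qed.

Lemma near_powR_dominated (C p q : R) : p < q ->
  \forall n \near \oo, C * n%:R `^ p <= n%:R `^ q.
Proof.
move=> pq; near=> n.
have n0 : 0 < n%:R :> R by rewrite ltr0n; near: n; exact: nbhs_infty_gt.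
have -> : q = (q - p) + p by rewrite subrK.
rewrite powRD; last by apply/implyP => _; rewrite gt_eqF.
rewrite ler_wpM2r ?powR_ge0 // -[n%:R]mul1r.
by near: n; apply: near_powR_ge; rewrite ?subr_gt0.
Unshelve. all: by end_near. Qed.

(** [F] and [X] stand for the hypergraph and graph extremal functions; [FX] is all that the
    estimates use of the combinatorics. *)
Variables (F X : nat -> nat).
Hypothesis FX : forall n z m, (m <= n)%N -> (0 < z)%N -> (m <= X z)%N ->
  (m * ((n - m) %/ z) <= F n)%N.

(* Take z about 2 (lambda n)^(1/alpha) and m about c (z/2)^alpha = c lambda n. *)
Lemma near_lower_bound c alpha lambda mu rho :
  0 < c -> 0 < alpha -> 0 < lambda -> 0 < mu -> 0 < rho < 1 ->
  (\forall z \near \oo, rho * (c * (z%:R / 2) `^ alpha) <= (X z)%:R) ->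
  (\forall n \near \oo,
     2 * (lambda * n%:R) `^ (alpha^-1) + (c * lambda + mu) * n%:R <= n%:R) ->
  \forall n \near \oo, rho `^ (alpha + 2) * mu * (c / 2) * lambda `^ (1 - alpha^-1) *
    n%:R `^ (2 - alpha^-1) <= (F n)%:R.
Proof.
move=> c0 a0 l0 mu0 /andP[r0 r1] [N0 _ hX] hy.
have ai0 : 0 < alpha^-1 by rewrite invr_gt0.
have ra0 : 0 < rho `^ alpha by rewrite powR_gt0.
near=> n.
have n0 : 0 < n%:R :> R by rewrite ltr0n; near: n; exact: nbhs_infty_gt.
pose y := (lambda * n%:R) `^ (alpha^-1).
have y0 : 0 < y by rewrite powR_gt0 // mulr_gt0.
have yn : 2 * y + (c * lambda + mu) * n%:R <= n%:R by rewrite /y; near: n; exact: hy.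
have ya : y `^ alpha = lambda * n%:R.
  by rewrite -powRrM mulVf ?gt_eqF // powRr1 // ltW // mulr_gt0.
(* Three thresholds: z reaches the range of [hX], and rounding z, then m, costs at most a factor rho
   each (for z, before taking the power alpha). *)
have yN0 : N0%:R + 1 <= y by rewrite /y; near: n; exact: near_powR_ge.
have yrho : (2 * (1 - rho))^-1 <= y by rewrite /y; near: n; exact: near_powR_ge.
have nrho : ((1 - rho) * rho * rho `^ alpha * c * lambda)^-1 <= n%:R.
  by near: n; exact: nbhs_infty_ger.
have N00 : 0 <= N0%:R :> R by [].
have cln : 0 < c * lambda * n%:R by rewrite !mulr_gt0.
have mun : 0 < mu * n%:R by rewrite mulr_gt0.
pose z := Num.truncn (2 * y).
have /andP[zy yz] : z%:R <= 2 * y < z.+1%:R by apply: truncn_itv; lra.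
rewrite -natr1 in yz.
have zN0 : (N0 <= z)%N by rewrite -(ler_nat R); lra.
have z0 : 0 < z%:R :> R by lra.
have z0n : (0 < z)%N by rewrite -(ltr_nat R).
have zrho : rho * y <= z%:R / 2.
  suff : 1 <= 2 * (1 - rho) * y by lra.
  by rewrite mulrC -ler_pdivrMr ?div1r //; lra.
have zle : (z%:R / 2) `^ alpha <= lambda * n%:R.
  by rewrite -ya; apply: ge0_ler_powR; rewrite ?nnegrE; lra.
have zge : rho `^ alpha * (lambda * n%:R) <= (z%:R / 2) `^ alpha.
  rewrite -ya -powRM; [|lra|lra].
  by apply: ge0_ler_powR; rewrite ?nnegrE //; try lra; rewrite mulr_ge0 //; lra.
pose t := rho * (c * (z%:R / 2) `^ alpha).
have t0 : 0 <= t by rewrite !mulr_ge0 ?powR_ge0 ?ltW.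
pose m := Num.truncn t.
have /andP[mt tm] : m%:R <= t < m.+1%:R by exact: truncn_itv.
rewrite -natr1 in tm.
have mX : (m <= X z)%N by rewrite -(ler_nat R); apply: le_trans mt (hX z zN0).
have tle : t <= c * lambda * n%:R.
  rewrite /t -mulrA; apply: (@le_trans _ _ (1 * (c * (z%:R / 2) `^ alpha))).
    by rewrite ler_wpM2r ?mulr_ge0 ?powR_ge0 // ltW.
  by rewrite mul1r ler_wpM2l // ltW.
have mn : (m <= n)%N by rewrite -(ler_nat R); lra.
have := FX mn z0n mX; set q := ((n - m) %/ z)%N => mqF.
have nq : n%:R - m%:R <= (q%:R + 1) * z%:R :> R.
  by rewrite -natrB // natr1 -natrM ler_nat ltnW // ltn_ceil.
have q0 : 0 <= q%:R :> R by [].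
(* Here qz >= n - m - z, and [yn] guarantees that this is at least mu n. *)
have hq : mu * n%:R <= q%:R * (2 * y).
  apply: (@le_trans _ _ (q%:R * z%:R)); last exact: ler_wpM2l.
  lra.
(* The losses are rho^alpha from rounding z, rho from [hX] and rho from rounding m. *)
have hm : rho `^ (alpha + 2) * (c * (lambda * n%:R)) <= m%:R.
  rewrite powRD; last by apply/implyP => _; rewrite gt_eqF.
  rewrite powR_mulrn; last exact: ltW.
  set A := rho `^ alpha * (lambda * n%:R) in zge.
  have tA : rho * c * A <= t.
    by rewrite /t -mulrA; apply: ler_wpM2l (ltW r0) _ _ (ler_wpM2l (ltW c0) zge).
  suff : 1 <= (1 - rho) * (rho * c * A) by rewrite /A in tA *; lra.
  rewrite /A; set K := _^-1 in nrho.
  have K0 : 0 < (1 - rho) * rho * rho `^ alpha * c * lambda.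
    by rewrite !mulr_gt0 // subr_gt0.
  move: nrho; rewrite /K -[X in X <= _]div1r ler_pdivrMr //.
  by lra.
have -> : rho `^ (alpha + 2) * mu * (c / 2) * lambda `^ (1 - alpha^-1) *
    n%:R `^ (2 - alpha^-1) =
    rho `^ (alpha + 2) * (c * (lambda * n%:R)) * (mu * n%:R / (2 * y)).
  rewrite /y !powRB; try by apply/implyP => _; rewrite gt_eqF.
  rewrite powRM ?powRr1 ?powR_mulrn ?ltW //.
  by field; rewrite !gt_eqF ?powR_gt0.
apply: (@le_trans _ _ (m * q)%:R); last by rewrite ler_nat.
rewrite natrM; apply: ler_pM => //.
- by rewrite !mulr_ge0 ?powR_ge0 ?ltW.
- by rewrite divr_ge0 ?mulr_ge0 ?ltW.
- by rewrite ler_pdivrMr // mulr_gt0.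
Unshelve. all: by end_near. Qed.

(** A single edge, m = 1, in a graph on a fixed number z of vertices already gives about n / z
    triples. *)
Lemma near_linear_bound c alpha rho : 0 < c -> 0 < rho ->
  (\forall z \near \oo, rho * (c * (z%:R / 2) `^ alpha) <= (X z)%:R) ->
  exists2 C : R, 0 < C & \forall n \near \oo, C * n%:R <= (F n)%:R.
Proof.
move=> c0 r0 [N0 _ hX].
have z0 : (0 < N0.+1)%N by [].
have X1 : (1 <= X N0.+1)%N.
  rewrite -(ltr_nat R); apply: lt_le_trans (hX _ (leqnSn N0)).
  by rewrite !mulr_gt0 // powR_gt0 // divr_gt0.
have zR : 0 < N0.+1%:R :> R by [].
exists (2 * N0.+1%:R)^-1; first by rewrite invr_gt0 mulr_gt0.
near=> n.
have n4 : 4 * N0.+1%:R <= n%:R :> R by near: n; exact: nbhs_infty_ger.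
have n1 : (1 <= n)%N by near: n; exact: nbhs_infty_ge.
have := FX n1 z0 X1; rewrite mul1n; set q := (_ %/ _)%N => qF.
have nq : n%:R <= (q%:R + 1) * N0.+1%:R :> R.
  by rewrite natr1 -natrM ler_nat -(subnK n1) addn1 ltn_ceil.
apply: (@le_trans _ _ q%:R); last by rewrite ler_nat.
rewrite mulrC ler_pdivrMr ?mulr_gt0 //; lra.
Unshelve. all: by end_near. Qed.

End Asymptotics.

Lemma near_ge_eqOmega (R : realType) (f g : nat -> R) (C : R) : 0 < C ->
  (forall n, 0 <= g n) -> (\forall n \near \oo, C * g n <= f n) -> f =Omega_\oo g.
Proof.
move=> C0 g0 fg; rewrite eqOmegaE qualifE; apply/asboolP; exists C => //.
apply: filterS fg => n fg; rewrite (ger0_norm (g0 n)).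
exact: le_trans fg (ler_norm _).
Qed.

(** * The choice of lambda and mu according to alpha *)

Theorem theorem3 (R : realType) (k : nat) (c alpha : R)
  (hk : (2 <= k)%N) (hc : 0 < c) (halpha : 0 < alpha)
  (hex : asymp_ge (fun n : nat => (ex_bip n (even_lengths (2 * k - 2)))%:R : R)
                  (fun n : nat => c * (n%:R / 2) `^ alpha)) :
  asymp_ge (fun n : nat => (ex_lin3 n (odd_lengths (2 * k + 1)))%:R : R)
           (fun n : nat =>
              (alpha * c) / (4 * alpha - 2)
              * ((alpha - 1) / (c * (2 * alpha - 1))) `^ (1 - alpha^-1)
              * n%:R `^ (2 - alpha^-1))
  /\ (fun n : nat => (ex_lin3 n (odd_lengths (2 * k + 1)))%:R : R)
       =Omega_\oo (fun n : nat => n%:R `^ (2 - alpha^-1) : R).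
Proof.
pose F n := ex_lin3 n (odd_lengths (2 * k + 1)).
pose X z := ex_bip z (even_lengths (2 * k - 2)).
have FX n z m : (m <= n)%N -> (0 < z)%N -> (m <= X z)%N ->
    (m * ((n - m) %/ z) <= F n)%N by exact: ex_lin3_ge_ex_bip.
have hX (rho : R) : rho < 1 ->
    \forall z \near \oo, rho * (c * (z%:R / 2) `^ alpha) <= (X z)%:R.
  by apply: asymp_ge_near hex _ => n; rewrite mulr_ge0 ?powR_ge0 // ltW.
have half0 : 0 < 2^-1 :> R by lra.
have half1 : 2^-1 < 1 :> R by lra.
have [alpha1|alpha1] := ltP alpha 1.
  have [C C0 CF] : exists2 C : R, 0 < C & \forall n \near \oo, C * n%:R <= (F n)%:R.
    exact: (near_linear_bound (alpha := alpha) FX hc half0 (hX _ half1)).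
  have FK (K : R) : \forall n \near \oo, K * n%:R `^ (2 - alpha^-1) <= (F n)%:R.
    have p1 : 2 - alpha^-1 < 1 by have := alpha1; rewrite -invf_gt1 //; lra.
    have := near_powR_dominated (K / C) p1; apply: filterS2 CF => n nF.
    rewrite powRr1 // mulrAC ler_pdivrMr // => nK; apply: le_trans nK _.
    by rewrite mulrC.
  split.
    exists (fun=> 0); first exact: cvg_cst.
    apply: filterS (FK ((alpha * c) / (4 * alpha - 2)
      * ((alpha - 1) / (c * (2 * alpha - 1))) `^ (1 - alpha^-1))) => n.
    by rewrite addr0 mul1r.
  by apply: (near_ge_eqOmega ltr01) (FK 1) => n; exact: powR_ge0.
set K := alpha * c / (4 * alpha - 2) *
  ((alpha - 1) / (c * (2 * alpha - 1))) `^ (1 - alpha^-1).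
have K0 : 0 < K.
  rewrite mulr_gt0 //; first by rewrite divr_gt0 ?mulr_gt0 //; lra.
  (* At alpha = 1 the power is 0^0, which evaluates to 1. *)
  have [->|alpha1'] := eqVneq alpha 1; first by rewrite invr1 subrr powRr0.
  have alpha1'' : 1 < alpha by rewrite lt_neqAle eq_sym alpha1'.
  by rewrite powR_gt0 // divr_gt0 ?mulr_gt0 //; lra.
suff FK (rho : R) : 0 < rho < 1 ->
    \forall n \near \oo, rho * (K * n%:R `^ (2 - alpha^-1)) <= (F n)%:R.
  split.
    by apply: near_asymp_ge FK => // n; rewrite mulr_ge0 ?powR_ge0 // ltW.
  apply: (@near_ge_eqOmega _ _ _ (2^-1 * K)); first by rewrite mulr_gt0.
    by move=> n; exact: powR_ge0.
  have half : 0 < (2^-1 : R) < 1 by rewrite half0.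
  by apply: filterS (FK _ half) => n; rewrite mulrA.
case/andP=> r0 r1.
(* near_lower_bound loses s^(alpha + 2), and the choice of mu one more factor. *)
pose s := rho `^ (alpha + 3)^-1.
have s0 : 0 < s by exact: powR_gt0.
have a30 : 0 < alpha + 3 by lra.
have sE : rho = s `^ (alpha + 2) * s.
  rewrite -[X in _ * X]powRr1 ?(ltW s0) // -powRD ?(gt_eqF s0) ?implybT //.
  rewrite (_ : alpha + 2 + 1 = alpha + 3); last lra.
  by rewrite -powRrM mulVf ?gt_eqF // powRr1 // ltW.
have s1 : s < 1.
  have := @gt0_ltr_powR R (alpha + 3)^-1 _ rho 1.
  rewrite powR1 invr_gt0 => -> //; rewrite nnegrE //; exact: ltW.
have s01 : 0 < s < 1 by rewrite s0.
have [a1|a1] := eqVneq alpha 1.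
  (* For alpha = 1 both z and m are linear in n; with mu = s this l solves 2 l + c l + mu = 1. *)
  pose l := (1 - s) / (c + 2).
  have l0 : 0 < l by rewrite divr_gt0 //; lra.
  have lE : (c + 2) * l = 1 - s by rewrite /l; field; rewrite gt_eqF //; lra.
  apply: filterS (near_lower_bound FX hc halpha l0 s0 s01 (hX s s1) _) => [n|].
    rewrite sE /K a1 invr1 subrr !powRr0; congr (_ <= _).
    by field.
  apply: nearW => n; rewrite a1 invr1 powRr1; last by rewrite mulr_ge0 // ltW.
  by rewrite mulrA -mulrDl (_ : 2 * l + (c * l + s) = 1) ?mul1r //; lra.
have {}a1 : 1 < alpha by rewrite lt_neqAle eq_sym a1.
(* This l maximizes l^(1 - 1/alpha) (1 - c l). With mu = s (1 - c l) the factor mu c / 2 equals s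
   alpha c / (4 alpha - 2). *)
pose l := (alpha - 1) / (c * (2 * alpha - 1)).
have l0 : 0 < l by rewrite divr_gt0 ?mulr_gt0 //; lra.
have d0 : 0 < 2 * alpha - 1 by lra.
have lE : 1 - c * l = alpha / (2 * alpha - 1) by rewrite /l; field; rewrite !gt_eqF.
have cl : 0 < 1 - c * l by rewrite lE divr_gt0.
have m0 : 0 < s * (1 - c * l) by rewrite mulr_gt0.
apply: filterS (near_lower_bound FX hc halpha l0 m0 s01 (hX s s1) _) => [n|].
  rewrite sE /K -/l lE; congr (_ <= _).
  by field; rewrite !gt_eqF //; lra.
have ai1 : alpha^-1 < 1 by rewrite invf_lt1.
(* The slack (1 - s)(1 - c l) n absorbs the term 2 (l n)^(1/alpha), of lower order since 1/alpha <
   1. *)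
have d1 : 0 < (1 - s) * (1 - c * l) by rewrite mulr_gt0 // subr_gt0.
apply: filterS (near_powR_dominated (2 * l `^ alpha^-1 / ((1 - s) * (1 - c * l))) ai1) => n.
rewrite powRr1 // mulrAC ler_pdivrMr // powRM ?(ltW l0) // mulrA.
by lra.
Qed.
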